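(* Let $g$ be a semi-discrete holomorphic function with $|g|\neq1$, and for real $\lambda\neq0$ (close to zero) let $n=n^{(\lambda)}$ be the semi-discrete CMC $1$ surface in $\mathbb{S}^{2,1}$ determined by $g$ and $\lambda$. Fix $(k,t)$ such that $(k,t)$ and $(k+1,t)$ lie in the domain. Then the edge $[n,n_1]=[n(k,t),n(k+1,t)]$ is a singular edge for all $\lambda\neq 0$ sufficiently close to zero if and only if the circle tangent to $\partial g$ at $g$ and tangent to $\partial g_1$ at $g_1$ intersects the unit circle $\mathbb{S}^1=\{z\in\mathbb{C}:|z|=1\}$ transversally.
   Context: Semi-discrete maps are maps $y(k,t)$ on a subdomain of $\mathbb{Z}\times\mathbb{R}$, smooth in $t$; write $y=y(k,t)$, $y_1=y(k+1,t)$, $\partial y=\frac{d}{dt}y$, $\Delta y=y_1-y$. $\mathbb{R}^{3,1}=\{(z_1,z_2,z_3,z_0)\}$ has metric $z_1w_1+z_2w_2+z_3w_3-z_0w_0$ and is identified with Hermitian $2\times2$ matrices by $(z_1,z_2,z_3,z_0)\mapsto\begin{pmatrix} z_0+z_3 & z_1-iz_2 \\ z_1+iz_2 & z_0-z_3 \end{pmatrix}$, so that the squared norm is $-\det$. $\mathbb{S}^{2,1}$ is the set of vectors of squared norm $1$. A semi-discrete holomorphic function is a map $g(k,t)\in\mathbb{C}$ with $\partial g$ and $\Delta g$ never zero and $\dfrac{\partial g\,\partial g_1}{(\Delta g)^2}=\dfrac{\tau(t)}{\sigma(k)}<0$ for real-valued functions $\tau$ of $t$ and $\sigma$ of $k$.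 Reality of this cross ratio guarantees a circle (possibly a line) through $g$ and $g_1$ tangent to $\partial g$ at $g$ and to $\partial g_1$ at $g_1$. Semi-discrete CMC $1$ surfaces in $\mathbb{S}^{2,1}$: the case $s=-1$ of the Weierstrass-type representation. Set $\mathcal{T}=1-|g|^2\ne0$ (standing genericity assumption), let $\lambda\in\mathbb{R}\setminus\{0\}$ with $1-\lambda\sigma\ne0$, let $E$ be a $\mathrm{GL}_2\mathbb{C}$-valued solution, with $\det E$ real, of $$E^{-1}\Delta E=\begin{pmatrix}0&\Delta g\\ \frac{\lambda\sigma}{\Delta g}&0\end{pmatrix},\qquad E^{-1}\partial E=\begin{pmatrix}0&\partial g\\ \frac{\lambda\tau}{\partial g}&0\end{pmatrix},$$ let $L=\begin{pmatrix}0&\sqrt{\mathcal{T}}\\ \frac{-1}{\sqrt{\mathcal{T}}}&\frac{\overline g}{\sqrt{\mathcal{T}}}\end{pmatrix}$, and set $$n=\frac{\mathrm{sgn}(\mathcal{T})}{\det E}EL\begin{pmatrix}1&0\\0&-1\end{pmatrix}(\overline{EL})^t\in\mathbb{S}^{2,1}.$$ The edge $[n,n_1]$ is a singular edge if the plane spanned by $\{\partial n,\Delta n,\partial\Delta n\}$ in $\mathbb{R}^{3,1}$ is not spacelike. *)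

(* Defs.v *)
From mathcomp Require Import all_boot all_order all_algebra.
From mathcomp Require Import complex.
From mathcomp Require Import all_classical all_reals all_analysis.
From mathcomp Require Import ring lra.

Set Implicit Arguments.
Unset Strict Implicit.
Unset Printing Implicit Defensive.

Import Order.TTheory GRing.Theory Num.Theory.
Import numFieldNormedType.Exports.
Local Open Scope classical_set_scope.
Local Open Scope complex_scope.
Local Open Scope ring_scope.

Section SemiDiscreteMaps.
Variable R : realType.
Local Notation C := (R[i]).
Local Notation reC := (@complex.Re R).
Local Notation imC := (@complex.Im R).

(* The library has no R-normed module structure on R[i], so derivatives of
   C-valued functions of a real variable are taken on real and imaginary
   parts. *)
Definition cderive (f : R -> C) (t : R) : C :=
  derive1 (reC \o f) t +i* derive1 (imC \o f) t.

Definition smooth_on (A : set R) (f : R -> R) : Prop :=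
  forall (m : nat) (t : R), A t -> derivable (derive1n m f) t 1.

Definition csmooth_on (A : set R) (f : R -> C) : Prop :=
  smooth_on A (reC \o f) /\ smooth_on A (imC \o f).

(* A domain in Z x R is given by its slices: D k is the set of all t such that
   (k, t) is in the domain. *)
Definition sd_domain (D : int -> set R) : Prop := forall k, open (D k).

Definition on_edge (D : int -> set R) (k : int) (t : R) : Prop :=
  D k t /\ D (k + 1) t.

Definition delta (V : zmodType) (y : int -> R -> V) (k : int) (t : R) : V :=
  y (k + 1) t - y k t.

Record sd_holomorphic (D : int -> set R) (g : int -> R -> C)
    (sigma : int -> R) (tau : R -> R) : Prop := {
  sd_hol_smooth : forall k, csmooth_on (D k) (g k);
  sd_hol_partial : forall k t, D k t -> cderive (g k) t != 0;
  sd_hol_delta : forall k t, on_edge D k t -> delta g k t != 0;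
  sd_hol_cross_ratio : forall k t, on_edge D k t ->
    cderive (g k) t * cderive (g (k + 1)) t / delta g k t ^+ 2
      = (tau t / sigma k)%:C;
  sd_hol_cross_ratio_lt0 : forall k t, on_edge D k t -> tau t / sigma k < 0
}.

End SemiDiscreteMaps.

Section Minkowski.
Variable R : realType.
Local Notation C := (R[i]).
Local Notation reC := (@complex.Re R).
Local Notation imC := (@complex.Im R).

(* The row vector (z_1, z_2, z_3, z_0); the timelike coordinate z_0 comes last,
   at index 3. *)
Definition mkv (z1 z2 z3 z0 : R) : 'rV[R]_4 :=
  \row_(j < 4) nth 0 [:: z1; z2; z3; z0] j.

Definition z1 (v : 'rV[R]_4) : R := v 0 (inord 0).
Definition z2 (v : 'rV[R]_4) : R := v 0 (inord 1).
Definition z3 (v : 'rV[R]_4) : R := v 0 (inord 2).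
Definition z0 (v : 'rV[R]_4) : R := v 0 (inord 3).

Definition lorentz (v w : 'rV[R]_4) : R :=
  z1 v * z1 w + z2 v * z2 w + z3 v * z3 w - z0 v * z0 w.

Definition mx22 (a b c d : C) : 'M[C]_2 :=
  \matrix_(i < 2, j < 2) nth 0 (nth [::] [:: [:: a; b]; [:: c; d]] i) j.

Definition herm_of_vec (v : 'rV[R]_4) : 'M[C]_2 :=
  mx22 (z0 v + z3 v)%:C (z1 v -i* z2 v)
       (z1 v +i* z2 v) (z0 v - z3 v)%:C.

(* The inverse of herm_of_vec on Hermitian matrices; see herm_of_vecK and
   vec_of_hermK. *)
Definition vec_of_herm (A : 'M[C]_2) : 'rV[R]_4 :=
  mkv (reC (A 1 0)) (imC (A 1 0))
      ((reC (A 0 0) - reC (A 1 1)) / 2)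
      ((reC (A 0 0) + reC (A 1 1)) / 2).

Definition conjtr (A : 'M[C]_2) : 'M[C]_2 := (map_mx Num.conj A)^T.

Lemma mkvE a b c d :
  [/\ z1 (mkv a b c d) = a, z2 (mkv a b c d) = b,
      z3 (mkv a b c d) = c & z0 (mkv a b c d) = d].
Proof. by split; rewrite /z0 /z1 /z2 /z3 mxE inordK. Qed.

Lemma mkv_eta v : mkv (z1 v) (z2 v) (z3 v) (z0 v) = v.
Proof.
apply/rowP => -[[|[|[|[|//]]]] lt_j4]; rewrite mxE /=;
  by congr (v 0 _); apply/val_inj; rewrite /= inordK.
Qed.

Lemma herm_of_vecK : cancel herm_of_vec vec_of_herm.
Proof.
move=> v; rewrite -[RHS]mkv_eta /vec_of_herm /herm_of_vec !mxE /=.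
by congr mkv; field.
Qed.

Lemma vec_of_hermK (A : 'M[C]_2) : conjtr A = A ->
  herm_of_vec (vec_of_herm A) = A.
Proof.
move=> AH; rewrite /herm_of_vec /vec_of_herm.
have [-> -> -> ->] := mkvE (reC (A 1 0)) (imC (A 1 0))
  ((reC (A 0 0) - reC (A 1 1)) / 2) ((reC (A 0 0) + reC (A 1 1)) / 2).
have H i j : Num.conj (A j i) = A i j by rewrite -[in RHS]AH !mxE.
have H00 := H 0 0; have H01 := H 0 1; have H11 := H 1 1.
apply/matrixP => i j; rewrite mxE.
have ord2 (l : 'I_2) : l = 0 \/ l = 1.
  by case: l => [[|[|//]]] lt_l2; [left|right]; apply/val_inj.
case: (ord2 i) => ->; case: (ord2 j) => -> /=.
- move: H00; case: (A 0 0) => a b [/= ab]; case: (A 1 1) => c d /=.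
  by apply/eqP; rewrite eq_complex /=; apply/andP; split; apply/eqP; lra.
- by rewrite -H01; case: (A 1 0).
- by case: (A 1 0).
- move: H11; case: (A 1 1) => a b [/= ab]; case: (A 0 0) => c d /=.
  by apply/eqP; rewrite eq_complex /=; apply/andP; split; apply/eqP; lra.
Qed.

Lemma lorentz_det v : (lorentz v v)%:C = - \det (herm_of_vec v).
Proof.
rewrite (expand_det_row _ 0) big_ord_recl big_ord1 /cofactor !det_mx11 !mxE /=.
apply/eqP; rewrite eq_complex /lorentz /=; simpc.
by apply/andP; split; apply/eqP; rewrite /=; ring.
Qed.

(* A subspace, given as the row space of a matrix. *)
Definition spacelike (m : nat) (U : 'M[R]_(m, 4)) : Prop :=
  forall v : 'rV[R]_4, (v <= U)%MS -> v != 0 -> 0 < lorentz v v.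

Definition singular_edge (n : int -> R -> 'rV[R]_4) (k : int) (t : R) : Prop :=
  ~ spacelike (derive1 (n k) t + delta n k t + derive1 (delta n k) t)%MS.

End Minkowski.

Section CMC1.
Variable R : realType.
Local Notation C := (R[i]).

Definition mxderive (E : R -> 'M[C]_2) (t : R) : 'M[C]_2 :=
  \matrix_(i, j) cderive (fun s => E s i j) t.

Definition mxsmooth_on (A : set R) (E : R -> 'M[C]_2) : Prop :=
  forall i j, csmooth_on A (fun s => E s i j).

(* sigma is only meaningful at those k that carry an edge of the domain. *)
Definition admissible (D : int -> set R) (sigma : int -> R) (lam : R) : Prop :=
  lam != 0 /\ forall k t, on_edge D k t -> 1 - lam * sigma k != 0.

Record cmc1_frame (D : int -> set R) (g : int -> R -> C) (sigma : int -> R)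
    (tau : R -> R) (lam : R) (E : int -> R -> 'M[C]_2) : Prop := {
  frame_smooth : forall k, mxsmooth_on (D k) (E k);
  frame_unit : forall k t, D k t -> E k t \in unitmx;
  frame_det_real : forall k t, D k t -> \det (E k t) \is Num.real;
  frame_delta : forall k t, on_edge D k t ->
    invmx (E k t) *m delta E k t
      = mx22 0 (delta g k t) ((lam * sigma k)%:C / delta g k t) 0;
  frame_partial : forall k t, D k t ->
    invmx (E k t) *m mxderive (E k) t
      = mx22 0 (cderive (g k) t) ((lam * tau t)%:C / cderive (g k) t) 0
}.

(* calT z is a real number, seen in C: sqrtC (calT z) is 'i * sqrtC `|calT z|
   when calT z < 0, and Num.sg is the usual sign on real arguments. *)
Definition calT (z : C) : C := 1 - `|z| ^+ 2.

Definition Lmx (z : C) : 'M[C]_2 :=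
  mx22 0 (sqrtC (calT z))
       (- 1 / sqrtC (calT z)) (Num.conj z / sqrtC (calT z)).

Definition cmc1 (g : int -> R -> C) (E : int -> R -> 'M[C]_2)
    (k : int) (t : R) : 'rV[R]_4 :=
  let EL := E k t *m Lmx (g k t) in
  vec_of_herm ((Num.sg (calT (g k t)) / \det (E k t)) *:
    (EL *m mx22 1 0 0 (- 1) *m conjtr EL)).

End CMC1.

Section Circles.
Variable R : realType.
Local Notation C := (R[i]).
Local Notation reC := (@complex.Re R).

Inductive gcircle : Type :=
| Circle of C & R   (* centre and radius *)
| Line of C & C.    (* point and direction *)

Definition gcircle_wf (c : gcircle) : Prop :=
  match c with
  | Circle _ r => 0 < r
  | Line _ v => v != 0
  end.

Definition on_gcircle (c : gcircle) (z : C) : Prop :=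
  match c with
  | Circle o r => `|z - o| = r%:C
  | Line p v => exists s : R, z = p + s%:C * v
  end.

(* w lies in the tangent space at a point z of c; for a circle, w is orthogonal
   to the radius at z. *)
Definition tangent_dir (c : gcircle) (z w : C) : Prop :=
  match c with
  | Circle o _ => reC (Num.conj (z - o) * w) = 0
  | Line _ v => exists s : R, w = s%:C * v
  end.

Definition tangent_to (c : gcircle) (z w : C) : Prop :=
  on_gcircle c z /\ tangent_dir c z w.

(* Tangent lines are distinct iff the only common tangent vector is 0. *)
Definition meets_transversally (c1 c2 : gcircle) : Prop :=
  (exists z, on_gcircle c1 z /\ on_gcircle c2 z) /\
  (forall z, on_gcircle c1 z -> on_gcircle c2 z ->
     forall w, tangent_dir c1 z w -> tangent_dir c2 z w -> w = 0).

Definition unit_circle : gcircle := Circle 0 1.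

End Circles.

(* Main.v *)
(* Write T = 1 - |g|^2, T1 = 1 - |g_1|^2, p = g', d = g_1 - g. The derivatives of
   n at both ends of the edge and the difference of n lie in the plane spanned by
   E P E^* and E Q E^*, where P and Q are explicit Hermitian matrices. Their Gram
   determinant is a positive multiple of
     T T1 (1 - lam sigma) |p|^2 |d|^2 - B^2,  B = Re (p (T conj d - |d|^2 conj g)),
   and P is spacelike, so the edge is singular iff this number is nonpositive.
   The circle through g and g_1 tangent to p at g meets the unit circle
   transversally iff A^2 < |d|^4 |p|^2, where A is the imaginary part of the
   number whose real part is B. Since A^2 + B^2 = |p|^2 |d|^2 (T T1 + |d|^2), this
   says that the limit of the Gram determinant as lam tends to 0 is negative.
   When that limit vanishes, T T1 > 0 and the Gram determinant changes sign with
   lam, so some small admissible lam gives a nonsingular edge; admissible lam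
   exist because only countably many are excluded. *)
Require Import Defs.
From mathcomp Require Import all_boot all_order all_algebra.
From mathcomp Require Import complex.
From mathcomp Require Import all_classical all_reals all_analysis.
From mathcomp Require Import ring lra.

Import Order.TTheory GRing.Theory Num.Theory.
Import numFieldNormedType.Exports.
Local Open Scope classical_set_scope.
Local Open Scope complex_scope.
Local Open Scope ring_scope.

Section SemiDiscreteCMC1.
Variable R : realType.
Local Notation C := (R[i]).
Implicit Types (a b q r s u v x y : R) (z p d : C) (A B X Y E : 'M[C]_2).

(** * Circles meeting the unit circle *)

Lemma Re2_Im2_gt0 z : z != 0 -> 0 < complex.Re z ^+ 2 + complex.Im z ^+ 2.
Proof. by move=> z0; rewrite -ltcR add_Re2_Im2 exprn_gt0 // normr_gt0. Qed.

Lemma Re2_Im2_neq1 z : `|z| != 1 -> 1 - complex.Re z ^+ 2 - complex.Im z ^+ 2 != 0.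
Proof.
apply: contra => /eqP z1; rewrite -(@sqrp_eq1 _ `|z|) ?normr_ge0 // -add_Re2_Im2.
have -> : complex.Re z ^+ 2 + complex.Im z ^+ 2 = 1 by lra.
exact: eqxx.
Qed.

Lemma normc_eqP a b r : 0 <= r ->
  `|a +i* b| = r%:C <-> a ^+ 2 + b ^+ 2 = r ^+ 2.
Proof.
move=> r0; rewrite normc_def /=; split=> [/complexI <- | ->].
  by rewrite sqr_sqrtr // addr_ge0 ?sqr_ge0.
by rewrite sqrtr_sqr ger0_norm.
Qed.

Lemma on_circleE a b r x y : 0 <= r ->
  on_gcircle (Circle (a +i* b) r) (x +i* y) <->
  (x - a) ^+ 2 + (y - b) ^+ 2 = r ^+ 2.
Proof. by move=> r0; rewrite -normc_eqP. Qed.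

Lemma tangent_circleE a b r x y u v :
  tangent_dir (Circle (a +i* b) r) (x +i* y) (u +i* v) <->
  (x - a) * u + (y - b) * v = 0.
Proof. by rewrite /=; split=> <-; ring. Qed.

(** The circles cross exactly when the distance D of their centres satisfies |r - 1| < D < r + 1.
    After squaring, this is the polynomial condition |D^2 - r^2 - 1| < 2 r. *)
Lemma circle_meets_unit a b r : 0 < r ->
  meets_transversally (Circle (a +i* b) r) (unit_circle R) <->
  (a ^+ 2 + b ^+ 2 - r ^+ 2 - 1) ^+ 2 < 4 * r ^+ 2.
Proof.
move=> r0; have r0' := ltW r0; split=> [[[[x y] [xyc xy1]] W] | H].
  have {}W := W _ xyc xy1.
  move: xyc xy1 => /(on_circleE _ _ _ _ _ r0') zr /(on_circleE _ _ _ _ _ ler01).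
  rewrite !subr0 expr1n => z1.
  (* If this determinant vanished, the centre would be collinear with 0 and the common point, and
     the nonzero vector (-y, x) would be tangent to both circles. *)
  have nz : a * y - b * x != 0.
    apply/eqP => abxy; have /W: tangent_dir (Circle (a +i* b) r) (x +i* y) (- y +i* x).
      by apply/tangent_circleE; move: abxy => /eqP; rewrite subr_eq0 => /eqP abxy; lra.
    have /[swap]/[apply] : tangent_dir (unit_circle R) (x +i* y) (- y +i* x).
      by apply/tangent_circleE; ring.
    move=> [/eqP]; rewrite oppr_eq0 => /eqP y0 x0.
    by move: z1 => /eqP; rewrite x0 y0 expr0n addr0 eq_sym oner_eq0.
  have : 0 < (a * y - b * x) ^+ 2 by rewrite exprn_even_gt0.
  have -> : a ^+ 2 + b ^+ 2 - r ^+ 2 - 1 = 2 * (a * x + b * y - 1).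
    by lra.
  have : (a * x + b * y - 1) ^+ 2 + (a * y - b * x) ^+ 2 = r ^+ 2.
    transitivity ((a ^+ 2 + b ^+ 2) * (x ^+ 2 + y ^+ 2) - 2 * (a * x + b * y) + 1).
      by ring.
    by rewrite z1; lra.
  by lra.
set m := a ^+ 2 + b ^+ 2.
have m0 : 0 < m.
  rewrite lt0r addr_ge0 ?sqr_ge0 // andbT; apply/eqP => m0.
  by move: H; rewrite -/m m0; have := sqr_ge0 (1 - r ^+ 2); lra.
(* A common point is sought as (c + i d)(a + i b). Subtracting the equations of the two circles
   gives c, and unit norm gives d; the hypothesis makes the radicand of d nonnegative. *)
pose c := (1 + m - r ^+ 2) / (2 * m).
pose d := Num.sqrt (m^-1 - c ^+ 2).
have d2 : d ^+ 2 = m^-1 - c ^+ 2.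
  rewrite sqr_sqrtr // subr_ge0.
  have -> : m^-1 = (4 * m) / (2 * m) ^+ 2 by field; rewrite gt_eqF.
  rewrite expr_div_n ler_pM2r ?invr_gt0 ?exprn_gt0 ?mulr_gt0 //.
  by move: H; rewrite -/m; lra.
have cE : 2 * m * c = 1 + m - r ^+ 2.
  by rewrite /c mulrC divfK // gt_eqF // mulr_gt0.
have mcd : m * (c ^+ 2 + d ^+ 2) = 1 by rewrite d2 addrC subrK divff // gt_eqF.
split=> [|[x y] /(on_circleE _ _ _ _ _ r0') zr /(on_circleE _ _ _ _ _ ler01)].
  exists ((a * c - b * d) +i* (b * c + a * d)); split.
    apply/on_circleE => //.
    transitivity (m * (c ^+ 2 + d ^+ 2) - 2 * m * c + m); first by rewrite /m; ring.
    by rewrite mcd cE; ring.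
  by apply/on_circleE => //; rewrite expr1n -mcd /m; ring.
rewrite !subr0 expr1n => z1 [u v] /tangent_circleE H1 /(tangent_circleE _ _ 1).
rewrite !subr0 => H2.
have nz : a * y - b * x != 0.
  apply/eqP => abxy; move: H; rewrite -subr_gt0.
  have -> : 4 * r ^+ 2 - (a ^+ 2 + b ^+ 2 - r ^+ 2 - 1) ^+ 2 =
    4 * (a * y - b * x) ^+ 2.
    have -> : a ^+ 2 + b ^+ 2 - r ^+ 2 - 1 = 2 * (a * x + b * y - 1) by lra.
    transitivity (4 * ((a ^+ 2 + b ^+ 2) * (x ^+ 2 + y ^+ 2) - (a * x + b * y) ^+ 2)).
      by rewrite z1; lra.
    by ring.
  by rewrite abxy expr0n mulr0 ltxx.
(* Cramer's rule: a * y - b * x is the determinant of the two tangency equations in u and v. *)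
have : (a * y - b * x) * u = 0.
  transitivity (y * (x * u + y * v) - y * ((x - a) * u + (y - b) * v)
    - b * (x * u + y * v)); first by ring.
  by rewrite H1 H2; ring.
have : (a * y - b * x) * v = 0.
  transitivity (a * (x * u + y * v) + x * ((x - a) * u + (y - b) * v)
    - x * (x * u + y * v)); first by ring.
  by rewrite H1 H2; ring.
move=> /eqP; rewrite mulf_eq0 (negbTE nz) => /eqP ->.
by move=> /eqP; rewrite mulf_eq0 (negbTE nz) => /eqP ->.
Qed.

(** The distance of the line from 0 is |a v - b u| / |u + i v|, and it has to be less than 1. *)
Lemma line_meets_unit a b u v : u +i* v != 0 ->
  meets_transversally (Line (a +i* b) (u +i* v)) (unit_circle R) <->
  (a * v - b * u) ^+ 2 < u ^+ 2 + v ^+ 2.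
Proof.
move=> uv0; have /= m0 := Re2_Im2_gt0 _ uv0.
split=> [[[[x y] [xyc xy1]] W] | H].
  have {}W := W _ xyc xy1; move: xy1 => /(on_circleE _ _ _ _ _ ler01).
  rewrite !subr0 expr1n => z1.
  have [s [/= xE yE]] := xyc.
  have nz : x * u + y * v != 0.
    apply/eqP => xuyv; move: uv0; rewrite (W (u +i* v)) ?eqxx //.
      by exists 1; rewrite mul1r.
    by apply/tangent_circleE; rewrite !subr0.
  have : 0 < (x * u + y * v) ^+ 2 by rewrite exprn_even_gt0.
  have -> : u ^+ 2 + v ^+ 2 = (u ^+ 2 + v ^+ 2) * (x ^+ 2 + y ^+ 2) by rewrite z1 mulr1.
  rewrite xE yE; lra.
set m := u ^+ 2 + v ^+ 2 in m0 H *.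
split=> [|[x y] [s [xE yE]] /(on_circleE _ _ _ _ _ ler01)].
  (* The parameter s of a common point solves a quadratic equation; completing the square turns it
     into (s m + a u + b v)^2 = m - (a v - b u)^2. *)
  pose d := Num.sqrt (m - (a * v - b * u) ^+ 2).
  have d2 : d ^+ 2 = m - (a * v - b * u) ^+ 2 by rewrite sqr_sqrtr // subr_ge0 ltW.
  pose s := (d - (a * u + b * v)) / m.
  have sE : s * m = d - (a * u + b * v) by rewrite divfK // gt_eqF.
  exists ((a + s * u) +i* (b + s * v)); split.
    by exists s; simpc.
  apply/on_circleE => //; rewrite !subr0 expr1n; apply: (mulfI (negbT (gt_eqF m0))).
  transitivity ((s * m + (a * u + b * v)) ^+ 2 + (a * v - b * u) ^+ 2).
    by rewrite /m; ring.
  by rewrite sE subrK d2; ring.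
rewrite !subr0 expr1n => z1 [w1 w2] [h /= [-> ->]] /(tangent_circleE _ _ 1).
rewrite !subr0 !mul0r subr0 addr0 => H2.
have nz : x * u + y * v != 0.
  apply/eqP => xuyv; move: H; rewrite -subr_gt0.
  have -> : m - (a * v - b * u) ^+ 2 = (x * u + y * v) ^+ 2.
    rewrite -[m]mulr1 -z1 xE yE /m /=; ring.
  by rewrite xuyv expr0n ltxx.
have : h * (x * u + y * v) = 0 by rewrite -[RHS]H2; ring.
move=> /eqP; rewrite mulf_eq0 (negbTE nz) orbF => /eqP ->.
by rewrite !mul0r.
Qed.

(** With z = a + i b, p = u + i v and d = x + i y, tangency to p at z and incidence with z + d fix
    the circle: its centre is z - i s p with 2 s (v x - u y) = |d|^2, and it is a line when p and d
    are parallel. Reality of the cross ratio then makes it tangent to the second vector at z + d. *)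
Lemma tangent_circle_meets_unit a b u v x y (w z : R) q :
  u +i* v != 0 -> x +i* y != 0 ->
  (u +i* v) * (w +i* z) = q%:C * (x +i* y) ^+ 2 ->
  (exists c : gcircle R,
     [/\ gcircle_wf c, tangent_to c (a +i* b) (u +i* v),
         tangent_to c ((a +i* b) + (x +i* y)) (w +i* z) &
         meets_transversally c (unit_circle R)]) <->
  ((1 - a ^+ 2 - b ^+ 2) * (v * x - u * y)
    - (x ^+ 2 + y ^+ 2) * (v * a - u * b)) ^+ 2
   < (x ^+ 2 + y ^+ 2) ^+ 2 * (u ^+ 2 + v ^+ 2).
Proof.
move=> p0 d0; have /= P0 := Re2_Im2_gt0 _ p0; have /= M0 := Re2_Im2_gt0 _ d0.
rewrite expr2; simpc => -[q1 q2].
set m := x ^+ 2 + y ^+ 2 in M0 *; set n := u ^+ 2 + v ^+ 2 in P0 *.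
set A := _ - m * _.
split=> [[c []]|HA].
case: c => [[h1 h2] r | [l1 l2] [v1 v2]] wf.
- have wf' := ltW wf.
  move=> -[/(on_circleE _ _ _ _ _ wf') gr /tangent_circleE gp].
  simpc; move=> -[/(on_circleE _ _ _ _ _ wf') g1r _] /(circle_meets_unit _ _ _ wf).
  (* The centre lies on the normal to p at z; s is its coordinate there in units of -i p. *)
  pose s := (u * (b - h2) - v * (a - h1)) / n.
  have sn : s * n = u * (b - h2) - v * (a - h1) by rewrite divfK // gt_eqF.
  have e1 : h1 = a + s * v.
    apply: (mulfI (negbT (gt_eqF P0))).
    transitivity (n * a + (s * n) * v); last by ring.
    rewrite sn; transitivity (n * h1 + u * ((a - h1) * u + (b - h2) * v)).
      by rewrite gp; ring.
    by rewrite /n; ring.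
  have e2 : h2 = b - s * u.
    apply: (mulfI (negbT (gt_eqF P0))).
    transitivity (n * b - (s * n) * u); last by ring.
    rewrite sn; transitivity (n * h2 + v * ((a - h1) * u + (b - h2) * v)).
      by rewrite gp; ring.
    by rewrite /n; ring.
  have r2 : r ^+ 2 = s ^+ 2 * n by rewrite -gr e1 e2 /n; ring.
  have sk : 2 * s * (v * x - u * y) = m.
    by move: g1r; rewrite r2 e1 e2 /n /m; lra.
  have k0 : v * x - u * y != 0.
    by apply/eqP => k0; move: M0; rewrite -sk k0 mulr0 ltxx.
  have k2 : 0 < (v * x - u * y) ^+ 2 by rewrite exprn_even_gt0.
  (* Multiplying by the square of v * x - u * y removes the denominator of s. *)
  rewrite -(ltr_pM2l k2) -exprMn.
  have -> : (v * x - u * y) * (h1 ^+ 2 + h2 ^+ 2 - r ^+ 2 - 1) = - A.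
    rewrite /A -sk r2 e1 e2 /n; ring.
  by rewrite sqrrN r2 -sk => H; apply: (lt_le_trans H); rewrite le_eqVlt; apply/orP; left; apply/eqP; ring.
- move=> -[[s]]; simpc => -[as1 bs1] [s' []] us vs.
  rewrite !(mul0r, subr0, addr0) in us vs.
  move=> -[[s2]]; simpc => -[as2 bs2] _ /(line_meets_unit _ _ _ _ wf) H.
  have s'0 : s' != 0.
    by apply/eqP => s'0; move: P0; rewrite /n us vs s'0; lra.
  have -> : A = - (m * (a * v - b * u)) * 1.
    rewrite /A; have -> : v * x - u * y = 0.
      have -> : x = (s2 - s) * v1 by lra.
      have -> : y = (s2 - s) * v2 by lra.
      by rewrite us vs; ring.
    ring.
  rewrite mulr1 sqrrN exprMn ltr_pM2l ?exprn_even_gt0 ?gt_eqF //.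
  rewrite (_ : a * v - b * u = s' * (l1 * v2 - l2 * v1)); last first.
    by rewrite as1 bs1 us vs; ring.
  by rewrite /n us vs !(exprMn _ s') -mulrDr ltr_pM2l ?exprn_even_gt0.
(* Multiplying p p1 = q d^2 by the conjugate of p gives the components of |p|^2 p1. *)
have w1 : n * w = q * (u * (x ^+ 2 - y ^+ 2) + 2 * v * x * y).
  transitivity (u * (u * w - v * z) + v * (u * z + v * w)); first by rewrite /n; ring.
  by rewrite q1 q2; ring.
have z1 : n * z = q * (2 * u * x * y - v * (x ^+ 2 - y ^+ 2)).
  transitivity (u * (u * z + v * w) - v * (u * w - v * z)); first by rewrite /n; ring.
  by rewrite q1 q2; ring.
have [k0|k0] := eqVneq (v * x - u * y) 0.
  pose s := (x * u + y * v) / n.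
  have sn : s * n = x * u + y * v by rewrite divfK // gt_eqF.
  have xs : x = s * u.
    apply: (mulfI (negbT (gt_eqF P0))).
    transitivity ((s * n) * u + v * (v * x - u * y)); last by rewrite k0; ring.
    by rewrite sn /n; ring.
  have ys : y = s * v.
    apply: (mulfI (negbT (gt_eqF P0))).
    transitivity ((s * n) * v - u * (v * x - u * y)); last by rewrite k0; ring.
    by rewrite sn /n; ring.
  exists (Line (a +i* b) (u +i* v)); split=> //.
  - split; first by exists 0; rewrite mul0r addr0.
    by exists 1; rewrite mul1r.
  - split; first by exists s; simpc; rewrite -xs -ys.
    exists (q * s ^+ 2); simpc; congr Complex; apply: (mulfI (negbT (gt_eqF P0))).
      by rewrite w1 xs ys /n; ring.
    by rewrite z1 xs ys /n; ring.
  apply/line_meets_unit => //; move: HA; rewrite /A k0 mulr0 sub0r sqrrN exprMn.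
  by rewrite ltr_pM2l ?exprn_even_gt0 ?gt_eqF // (mulrC v) (mulrC u).
pose s := m / (2 * (v * x - u * y)).
have sk : 2 * s * (v * x - u * y) = m by rewrite /s; field.
have r0 : 0 < `|s| * Num.sqrt n.
  rewrite mulr_gt0 ?sqrtr_gt0 // normr_gt0; apply/eqP => s0.
  by move: M0; rewrite -sk s0 mulr0 mul0r ltxx.
have r2 : (`|s| * Num.sqrt n) ^+ 2 = s ^+ 2 * n.
  by rewrite exprMn real_normK ?num_real // sqr_sqrtr // ltW.
exists (Circle ((a + s * v) +i* (b - s * u)) (`|s| * Num.sqrt n)); split=> //.
- split; first by apply/on_circleE; rewrite ?ltW // r2 /n; ring.
  by apply/tangent_circleE; ring.
- simpc; split.
    apply/on_circleE; rewrite ?ltW // r2.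
    transitivity (s ^+ 2 * n + m - 2 * s * (v * x - u * y)); first by rewrite /n /m; ring.
    by rewrite sk; ring.
  apply/tangent_circleE; apply: (mulfI (negbT (gt_eqF P0))); rewrite mulr0.
  transitivity ((x - s * v) * (n * w) + (y + s * u) * (n * z)); first by ring.
  rewrite w1 z1.
  transitivity (q * (u * x + v * y) * (m - 2 * s * (v * x - u * y))); first by rewrite /m; ring.
  by rewrite sk subrr mulr0.
apply/circle_meets_unit => //.
have k2 : 0 < (v * x - u * y) ^+ 2 by rewrite exprn_even_gt0.
  rewrite -(ltr_pM2l k2) -exprMn r2.
have -> : (v * x - u * y) * ((a + s * v) ^+ 2 + (b - s * u) ^+ 2 - s ^+ 2 * n - 1) = - A.
  rewrite /A -sk /n; ring.
rewrite sqrrN; apply: (lt_le_trans HA); rewrite -[X in X ^+ 2 * n]sk.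
by rewrite le_eqVlt; apply/orP; left; apply/eqP; ring.
Qed.
(** * Minkowski space as Hermitian matrices *)

Lemma lorentz_comb (u w : 'rV[R]_4) x y :
  lorentz (x *: u + y *: w) (x *: u + y *: w) =
  x ^+ 2 * lorentz u u + 2 * x * y * lorentz u w + y ^+ 2 * lorentz w w.
Proof. by rewrite /lorentz /z1 /z2 /z3 /z0 !mxE; ring. Qed.

Lemma lorentz_polar (u w : 'rV[R]_4) :
  2 * lorentz u w = lorentz (u + w) (u + w) - lorentz u u - lorentz w w.
Proof. by have := lorentz_comb u w 1 1; rewrite !scale1r => ->; ring. Qed.

(** Sylvester's criterion for the Gram matrix of u and w. *)
Lemma spacelike_plane m (U : 'M[R]_(m, 4)) (u w : 'rV[R]_4) : (U == u + w)%MS ->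
  0 < lorentz u u -> (forall x, w != x *: u) ->
  spacelike U <-> lorentz u w ^+ 2 < lorentz u u * lorentz w w.
Proof.
move=> /eqmxP Ueq u0 wu; split=> [sU | G v].
  (* This vector is [lorentz u u] times the part of w orthogonal to u, so its squared norm is
     [lorentz u u] times the Gram determinant. *)
  have vU : (((- lorentz u w) *: u + lorentz u u *: w)%R <= U)%MS.
    by rewrite Ueq addmx_sub ?scalemx_sub ?addsmxSl ?addsmxSr.
  have v0 : (- lorentz u w) *: u + lorentz u u *: w != 0.
    apply: contra (wu (lorentz u w / lorentz u u)).
    rewrite scaleNr addrC subr_eq0 => /eqP uw.
    by rewrite mulrC -scalerA -uw scalerA mulVf ?scale1r ?gt_eqF.
  have H := sU _ vU v0; rewrite lorentz_comb in H.
  rewrite -subr_gt0 -(pmulr_rgt0 _ u0); move: H; lra.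
rewrite Ueq => /sub_addsmxP [[a b] /= ->].
rewrite [a]mx11_scalar [b]mx11_scalar !mul_scalar_mx.
set x := a 0 0; set y := b 0 0; move=> v0.
rewrite lorentz_comb -(pmulr_rgt0 _ u0).
have -> : lorentz u u * (x ^+ 2 * lorentz u u + 2 * x * y * lorentz u w + y ^+ 2 * lorentz w w)
  = (lorentz u u * x + lorentz u w * y) ^+ 2
    + y ^+ 2 * (lorentz u u * lorentz w w - lorentz u w ^+ 2) by ring.
have [y0|y0] := eqVneq y 0.
  have x0 : x != 0 by apply: contra v0 => /eqP ->; rewrite y0 !scale0r addr0.
  rewrite y0 mulr0 expr0n mul0r !addr0 exprn_even_gt0 //=.
  by rewrite mulf_neq0 // gt_eqF.
by rewrite ltr_wpDl ?sqr_ge0 // mulr_gt0 ?subr_gt0 // exprn_even_gt0.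
Qed.

(** * Two by two complex matrices and congruence *)

Lemma ord2P (i : 'I_2) : i = 0 \/ i = 1.
Proof.
by case: i => [[|[|//]]] lt_i2; [left|right]; apply/val_inj.
Qed.

Lemma mx22_eta A : A = mx22 (A 0 0) (A 0 1) (A 1 0) (A 1 1).
Proof.
by apply/matrixP => i j; rewrite mxE; case: (ord2P i) => ->; case: (ord2P j) => ->.
Qed.

Lemma mx22D (a b c d a' b' c' d' : C) :
  mx22 a b c d + mx22 a' b' c' d' = mx22 (a + a') (b + b') (c + c') (d + d').
Proof.
by apply/matrixP => i j; rewrite !mxE; case: (ord2P i) => ->; case: (ord2P j) => ->.
Qed.

Lemma mx22Z (k a b c d : C) : k *: mx22 a b c d = mx22 (k * a) (k * b) (k * c) (k * d).
Proof.
by apply/matrixP => i j; rewrite !mxE; case: (ord2P i) => ->; case: (ord2P j) => ->.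
Qed.

Lemma mx22N (a b c d : C) : - mx22 a b c d = mx22 (- a) (- b) (- c) (- d).
Proof.
by apply/matrixP => i j; rewrite !mxE; case: (ord2P i) => ->; case: (ord2P j) => ->.
Qed.

Lemma mx22M (a b c d a' b' c' d' : C) : mx22 a b c d *m mx22 a' b' c' d' =
  mx22 (a * a' + b * c') (a * b' + b * d') (c * a' + d * c') (c * b' + d * d').
Proof.
apply/matrixP => i j; rewrite !mxE big_ord_recl big_ord1 !mxE.
by case: (ord2P i) => ->; case: (ord2P j) => ->.
Qed.

Lemma mx22_id : 1%:M = mx22 1 0 0 1 :> 'M[C]_2.
Proof.
by apply/matrixP => i j; rewrite !mxE; case: (ord2P i) => ->; case: (ord2P j) => ->.
Qed.

Lemma conjtr_mx22 (a b c d : C) : conjtr (mx22 a b c d) =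
  mx22 (Num.conj a) (Num.conj c) (Num.conj b) (Num.conj d).
Proof.
by apply/matrixP => i j; rewrite !mxE; case: (ord2P i) => ->; case: (ord2P j) => ->.
Qed.

Lemma det_mx22E A : \det A = A 0 0 * A 1 1 - A 0 1 * A 1 0.
Proof.
rewrite (expand_det_row _ 0) big_ord_recl big_ord1 /cofactor !det_mx11 !mxE /=.
rewrite (_ : lift 0 0 = 1); last by apply/val_inj.
rewrite (_ : lift 1 0 = 0); last by apply/val_inj.
by rewrite expr0 expr1 mul1r mulN1r mulrN.
Qed.

Lemma det_mx22 (a b c d : C) : \det (mx22 a b c d) = a * d - b * c.
Proof. by rewrite det_mx22E !mxE. Qed.

Lemma conjtrK : involutive (@conjtr R).
Proof. by move=> A; rewrite [A]mx22_eta !conjtr_mx22 !conjCK. Qed.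

Lemma conjtrM A B : conjtr (A *m B) = conjtr B *m conjtr A.
Proof. by rewrite /conjtr map_mxM trmx_mul. Qed.

Lemma conjtrD A B : conjtr (A + B) = conjtr A + conjtr B.
Proof. by rewrite /conjtr map_mxD linearD. Qed.

Lemma det_conjtr A : \det (conjtr A) = Num.conj (\det A).
Proof. by rewrite /conjtr det_tr det_map_mx. Qed.

(** The action of GL_2(C) on Hermitian matrices; up to the factor |det E| it is a Lorentz
    transformation. *)
Definition congr E X : 'M[C]_2 := E *m X *m conjtr E.

Lemma congrD E X Y : congr E (X + Y) = congr E X + congr E Y.
Proof. by rewrite /congr mulmxDr mulmxDl. Qed.

Lemma congrZ E (k : C) X : congr E (k *: X) = k *: congr E X.
Proof. by rewrite /congr -scalemxAr -scalemxAl. Qed.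

Lemma congr_mul E F X : congr (E *m F) X = congr E (congr F X).
Proof. by rewrite /congr conjtrM !mulmxA. Qed.

Lemma congr_herm E X : conjtr X = X -> conjtr (congr E X) = congr E X.
Proof. by move=> XH; rewrite /congr !conjtrM conjtrK XH mulmxA. Qed.

Lemma vec_of_hermD A B : vec_of_herm (A + B) = vec_of_herm A + vec_of_herm B.
Proof.
apply/rowP => j; rewrite /vec_of_herm !mxE !raddfD /=.
by case: j => [[|[|[|[|//]]]]] ? /=; field.
Qed.

Lemma vec_of_hermZ x A : vec_of_herm (x%:C *: A) = x *: vec_of_herm A.
Proof.
have ReZ (z : C) : complex.Re (x%:C * z) = x * complex.Re z by case: z => ? ?; simpc.
have ImZ (z : C) : complex.Im (x%:C * z) = x * complex.Im z by case: z => ? ?; simpc.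
apply/rowP => j; rewrite /vec_of_herm !mxE !(ReZ, ImZ).
by case: j => [[|[|[|[|//]]]]] ? /=; field.
Qed.

Lemma lorentz_vec A : conjtr A = A ->
  (lorentz (vec_of_herm A) (vec_of_herm A))%:C = - \det A.
Proof. by move=> AH; rewrite lorentz_det vec_of_hermK. Qed.

(** The squared norm is minus the determinant, which is multiplicative; polarization extends the
    scaling from norms to products. *)
Lemma lorentz_congr E X Y : conjtr X = X -> conjtr Y = Y ->
  lorentz (vec_of_herm (congr E X)) (vec_of_herm (congr E Y)) =
  complex.Re (`|\det E| ^+ 2) * lorentz (vec_of_herm X) (vec_of_herm Y).
Proof.
have diag Z : conjtr Z = Z -> lorentz (vec_of_herm (congr E Z)) (vec_of_herm (congr E Z)) =
    complex.Re (`|\det E| ^+ 2) * lorentz (vec_of_herm Z) (vec_of_herm Z).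
  move=> ZH; apply: (@complexI R).
  have MC x y : (x * y)%:C = x%:C * y%:C by rewrite -rmorphM.
  rewrite MC !lorentz_vec ?congr_herm //.
  rewrite RRe_real ?rpredX ?normr_real // /congr !det_mulmx det_conjtr.
  by rewrite normCK; ring.
move=> XH YH; apply: (mulfI (_ : 2 != 0)); first by rewrite pnatr_eq0.
rewrite mulrCA !lorentz_polar -!vec_of_hermD -congrD.
by rewrite !diag // ?conjtrD ?XH ?YH //; ring.
Qed.

Lemma conjC_real x : Num.conj (x%:C : C) = x%:C.
Proof. exact: conjc_real. Qed.

(** Rewrite rules that push conjugation down to the variables, so that [ring] and [field] treat z
    and its conjugate as independent atoms. *)
Definition conjE :=
  ((fun x y : C => rmorphD Num.conj x y : Num.conj (x + y) = Num.conj x + Num.conj y),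
   (fun x : C => rmorphN Num.conj x : Num.conj (- x) = - Num.conj x),
   (fun x y : C => rmorphM Num.conj x y : Num.conj (x * y) = Num.conj x * Num.conj y),
   (fun x : C => fmorphV Num.conj x : Num.conj x^-1 = (Num.conj x)^-1),
   (fun n (x : C) => rmorphXn Num.conj n x : Num.conj (x ^+ n) = Num.conj x ^+ n),
   (rmorph0 Num.conj : Num.conj 0 = 0 :> C), (rmorph1 Num.conj : Num.conj 1 = 1 :> C),
   (@conjCK C), conjC_real).

(** The product sgn(T) L diag(1, -1) L^* freed of square roots, for T = 1 - |z|^2 nonzero. Its
    determinant is -1. *)
Definition gauss_mx (z : C) : 'M[C]_2 := mx22 (z * Num.conj z - 1) (- z) (- Num.conj z) 1.

(** * Tangent and edge directions of the surface *)

(* With M = gauss_mx g one has n = E M E^* / det E (cmc1E). Up to nonzero real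
   factors, the derivative of n is E (smooth_dir g g') E^* and the difference of
   n is E (discrete_dir g (delta g) (lam * sigma)) E^*. *)
Definition smooth_dir (z p : C) : 'M[C]_2 :=
  let T := 1 - z * Num.conj z in
  mx22 0 (T / Num.conj p) (T / p) (z / p + Num.conj z / Num.conj p).

Definition discrete_dir (z d : C) (a : R) : 'M[C]_2 :=
  let T := 1 - z * Num.conj z in
  let T1 := 1 - (z + d) * Num.conj (z + d) in
  mx22 T (T / Num.conj d) (T / d)
    (1 + z / d + Num.conj z / Num.conj d + a%:C * T1 / (d * Num.conj d)).

(** The factor 1 + E^-1 (Delta E) that carries the frame along an edge, with a = lam * sigma; its
    determinant is 1 - a. *)
Definition step_mx (d : C) (a : R) : 'M[C]_2 := mx22 1 d (a%:C / d) 1.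

Lemma conjC_realP (z : C) : Num.conj z = z -> exists x : R, z = x%:C.
Proof. by move=> zz; apply/complex_realP; apply/CrealP. Qed.

Lemma smooth_dir_herm z p : conjtr (smooth_dir z p) = smooth_dir z p.
Proof.
rewrite /smooth_dir conjtr_mx22 !conjE.
by congr mx22; ring.
Qed.

Lemma discrete_dir_herm z d a : conjtr (discrete_dir z d a) = discrete_dir z d a.
Proof.
rewrite /discrete_dir conjtr_mx22 !invfM !conjE.
by congr mx22; ring.
Qed.

Lemma calTE z : calT z = 1 - z * Num.conj z :> C.
Proof. by rewrite /calT normCK. Qed.

Lemma cmc1E g (E : int -> R -> 'M[C]_2) k t : calT (g k t) != 0 ->
  cmc1 g E k t = vec_of_herm ((\det (E k t))^-1 *: congr (E k t) (gauss_mx (g k t))).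
Proof.
set z := g k t; set T := calT z => T0.
have Treal : T \is Num.real by rewrite /T /calT rpredB ?rpred1 // rpredX // normr_real.
rewrite /cmc1 -/z -/T; congr vec_of_herm.
rewrite mulrC -scalerA; congr (_ *: _); rewrite conjtrM !mulmxA.
rewrite /congr -!mulmxA scalemxAr; congr (_ *m _).
rewrite !mulmxA scalemxAl; congr (_ *m _).
set s : C := sqrtC T.
have s2 : s ^+ 2 = T by exact: sqrtCK.
have s0 : s != 0 by rewrite sqrtC_eq0.
have ss : s * Num.conj s = `|T| by rewrite -normCK -normrX s2.
have sg2 : Num.sg T ^+ 2 = 1 by rewrite sqr_sg T0.
have sgsg : Num.sg T * T = `|T|.
  by rewrite {2}(realEsg Treal) mulrA -expr2 sg2 mul1r.
have cs0 : Num.conj s != 0 by rewrite fmorph_eq0.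
(* The root s is real for T > 0 and purely imaginary for T < 0. The resulting sign is cancelled by
   sgn(T) in the definition of n. *)
have cs : Num.conj s = Num.sg T * s.
  by apply: (mulfI s0); rewrite ss mulrCA -expr2 s2 sgsg.
have TE : s ^+ 2 = 1 - z * Num.conj z by rewrite s2 /T calTE.
rewrite /Lmx -/T -/s conjtr_mx22 !mx22M mx22Z /gauss_mx.
rewrite !conjE cs.
have sgT0 : Num.sg T != 0 by rewrite sgr_eq0.
congr mx22.
- transitivity (- Num.sg T ^+ 2 * s ^+ 2); first by ring.
  by rewrite sg2 TE; ring.
- by field; rewrite s0 sgT0.
- by transitivity (- Num.sg T ^+ 2 * Num.conj z); [field; rewrite s0 | rewrite sg2; ring].
- transitivity ((1 - z * Num.conj z) / s ^+ 2); first by field; rewrite s0 sgT0.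
  by rewrite TE divff // -TE expf_neq0.
Qed.

(** After division by the determinant 1 - a of the step, the difference of n across the edge is left
    as a multiple of [discrete_dir]. *)
Lemma congr_step_gauss z d a : d != 0 ->
  congr (step_mx d a) (gauss_mx (z + d)) =
  (1 - a)%:C *: gauss_mx z - a%:C *: discrete_dir z d a.
Proof.
move=> d0; have cd0 : Num.conj d != 0 by rewrite fmorph_eq0.
rewrite /congr /step_mx /gauss_mx /discrete_dir conjtr_mx22 !mx22Z mx22N mx22D !mx22M.
rewrite !conjE.
by congr mx22; field; rewrite ?d0 ?cd0.
Qed.

(* Planarity: transported back to the vertex k, the derivative of n at k + 1 lies
   in the plane spanned by the other two vectors. This needs the cross ratio q
   to be real, and the coefficients x, y are read off the first row. *)
Lemma congr_step_smooth z p d a q : p != 0 -> d != 0 -> q != 0 ->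
  1 - z * Num.conj z != 0 ->
  exists x y : R, congr (step_mx d a) (smooth_dir (z + d) (q%:C * d ^+ 2 / p)) =
    x%:C *: smooth_dir z p + y%:C *: discrete_dir z d a.
Proof.
move=> p0 d0 q0 T0; have cd0 : Num.conj d != 0 by rewrite fmorph_eq0.
have cp0 : Num.conj p != 0 by rewrite fmorph_eq0.
have q0' : q%:C != 0 :> C by rewrite fmorph_eq0.
pose T := 1 - z * Num.conj z.
pose T1 := 1 - (z + d) * Num.conj (z + d).
have /conjC_realP [x xE] : Num.conj (- (p / d * Num.conj (p / d)) * T1 * (1 - a)%:C / (q%:C * T))
    = - (p / d * Num.conj (p / d)) * T1 * (1 - a)%:C / (q%:C * T).
  rewrite /T /T1 !conjE.
  by field; apply/and4P.
have /conjC_realP [y yE] : Num.conj ((T * (p / d + Num.conj (p / d))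
     - (Num.conj z * p + z * Num.conj p)) / (q%:C * T))
    = (T * (p / d + Num.conj (p / d)) - (Num.conj z * p + z * Num.conj p)) / (q%:C * T).
  rewrite /T /T1 !conjE.
  by field; apply/and4P.
exists x, y; rewrite -xE -yE /T /T1.
rewrite /congr /step_mx /smooth_dir /discrete_dir conjtr_mx22 !mx22Z mx22D !mx22M.
rewrite !conjE.
by congr mx22; field; do ?[apply/andP; split].
Qed.

Definition realCE :=
  ((fun x y : R => rmorphD (real_complex R) x y : (x + y)%:C = x%:C + y%:C),
   (fun x : R => rmorphN (real_complex R) x : (- x)%:C = - x%:C),
   (fun x y : R => rmorphM (real_complex R) x y : (x * y)%:C = x%:C * y%:C),
   (fun x : R => fmorphV (real_complex R) x : (x^-1)%:C = (x%:C)^-1),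
   (fun n (x : R) => rmorphXn (real_complex R) n x : (x ^+ n)%:C = x%:C ^+ n),
   (fun n => rmorph_nat (real_complex R) n : (n%:R)%:C = n%:R)).

Lemma lorentz_vec_polar A B : conjtr A = A -> conjtr B = B ->
  (2 * lorentz (vec_of_herm A) (vec_of_herm B))%:C =
  \det A + \det B - \det (A + B).
Proof.
move=> AH BH; have ABH : conjtr (A + B) = A + B by rewrite conjtrD AH BH.
rewrite lorentz_polar -vec_of_hermD.
move: (lorentz_vec _ ABH) (lorentz_vec _ AH) (lorentz_vec _ BH).
move: (lorentz _ _) (lorentz _ _) (lorentz _ _) => x y s; rewrite !realCE => -> -> ->.
by ring.
Qed.

Lemma lorentz_smooth_dir z p : p != 0 ->
  (lorentz (vec_of_herm (smooth_dir z p)) (vec_of_herm (smooth_dir z p)))%:C =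
  (1 - z * Num.conj z) ^+ 2 / (p * Num.conj p).
Proof.
move=> p0; rewrite lorentz_vec ?smooth_dir_herm // /smooth_dir det_mx22.
by field; rewrite fmorph_eq0 p0.
Qed.

Lemma lorentz_discrete_dir z d a : d != 0 ->
  (lorentz (vec_of_herm (discrete_dir z d a)) (vec_of_herm (discrete_dir z d a)))%:C =
  (1 - z * Num.conj z) * (1 - (z + d) * Num.conj (z + d)) * (1 - a)%:C / (d * Num.conj d).
Proof.
move=> d0; rewrite lorentz_vec ?discrete_dir_herm // /discrete_dir det_mx22 !conjE.
rewrite !realCE.
by field; rewrite fmorph_eq0 d0.
Qed.

Lemma lorentz_smooth_discrete z p d a : p != 0 -> d != 0 ->
  (2 * lorentz (vec_of_herm (smooth_dir z p)) (vec_of_herm (discrete_dir z d a)))%:C =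
  (1 - z * Num.conj z) *
    ((1 - z * Num.conj z) * (p * Num.conj d + Num.conj p * d)
      - d * Num.conj d * (p * Num.conj z + Num.conj p * z))
  / (p * Num.conj p * (d * Num.conj d)).
Proof.
move=> p0 d0; rewrite lorentz_vec_polar ?smooth_dir_herm ?discrete_dir_herm //.
rewrite /discrete_dir /smooth_dir mx22D !det_mx22 !conjE.
by field; rewrite !fmorph_eq0 p0 d0.
Qed.

Lemma congrK E : E \in unitmx -> cancel (congr E) (congr (invmx E)).
Proof.
by move=> Eu X; rewrite -congr_mul mulVmx // /congr mul1mx /conjtr map_mx1 trmx1 mulmx1.
Qed.

Lemma vec_of_herm_inj A B : conjtr A = A -> conjtr B = B ->
  vec_of_herm A = vec_of_herm B -> A = B.
Proof. by move=> AH BH AB; rewrite -(vec_of_hermK AH) AB vec_of_hermK. Qed.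

Lemma conjtr_real_scale x X : conjtr X = X -> conjtr (x%:C *: X) = x%:C *: X.
Proof. by move=> XH; rewrite /conjtr map_mxZ linearZ /= conjC_real -[in RHS]XH. Qed.

(** Congruence by an invertible matrix is injective, and the upper left entry is 0 for [smooth_dir]
    but T, which is nonzero, for [discrete_dir]. *)
Lemma independent_dirs E z p d a x : E \in unitmx -> 1 - z * Num.conj z != 0 ->
  vec_of_herm (congr E (discrete_dir z d a)) != x *: vec_of_herm (congr E (smooth_dir z p)).
Proof.
move=> Eu; apply: contra => /eqP; rewrite -vec_of_hermZ -congrZ => /vec_of_herm_inj QP.
have /(can_inj (congrK _ Eu)) : congr E (discrete_dir z d a) = congr E (x%:C *: smooth_dir z p).
  by apply: QP; apply: congr_herm; rewrite ?discrete_dir_herm ?conjtr_real_scale ?smooth_dir_herm.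
by move=> /matrixP/(_ 0 0); rewrite !mxE /= mulr0 => ->.
Qed.

Lemma spacelike_edge_plane m (U : 'M[R]_(m, 4)) E z p d a :
  let T := 1 - complex.Re z ^+ 2 - complex.Im z ^+ 2 in
  let T1 := 1 - complex.Re (z + d) ^+ 2 - complex.Im (z + d) ^+ 2 in
  let np := complex.Re p ^+ 2 + complex.Im p ^+ 2 in
  let nd := complex.Re d ^+ 2 + complex.Im d ^+ 2 in
  E \in unitmx -> p != 0 -> d != 0 -> T != 0 ->
  (U == vec_of_herm (congr E (smooth_dir z p)) + vec_of_herm (congr E (discrete_dir z d a)))%MS ->
  spacelike U <->
  (T * (complex.Re p * complex.Re d + complex.Im p * complex.Im d)
   - nd * (complex.Re p * complex.Re z + complex.Im p * complex.Im z)) ^+ 2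
  < T * T1 * (1 - a) * np * nd.
Proof.
move=> T T1 np nd Eu p0 d0 T0 Ueq.
have normE (w : C) : w * Num.conj w = (complex.Re w ^+ 2 + complex.Im w ^+ 2)%:C.
  by rewrite add_Re2_Im2 normCK.
have TE (w : C) : 1 - w * Num.conj w = (1 - complex.Re w ^+ 2 - complex.Im w ^+ 2)%:C.
  by rewrite normE !realCE; ring.
have dotE (w w' : C) : w * Num.conj w' + Num.conj w * w' =
    (2 * (complex.Re w * complex.Re w' + complex.Im w * complex.Im w'))%:C.
  by case: w w' => [w1 w2] [w1' w2'] /=; simpc; congr Complex; ring.
have np0 : 0 < np by exact: Re2_Im2_gt0.
have nd0 : 0 < nd by exact: Re2_Im2_gt0.
have e0 : 0 < complex.Re (`|\det E| ^+ 2).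
  rewrite -ltcR RRe_real ?rpredX ?normr_real // exprn_gt0 // normr_gt0.
  by rewrite -unitfE -unitmxE.
have PP : lorentz (vec_of_herm (smooth_dir z p)) (vec_of_herm (smooth_dir z p)) = T ^+ 2 / np.
  by apply: complexI; rewrite lorentz_smooth_dir // TE normE !realCE.
have QQ : lorentz (vec_of_herm (discrete_dir z d a)) (vec_of_herm (discrete_dir z d a)) =
   T * T1 * (1 - a) / nd.
  by apply: complexI; rewrite lorentz_discrete_dir // !TE normE !realCE.
have PQ : lorentz (vec_of_herm (smooth_dir z p)) (vec_of_herm (discrete_dir z d a)) =
   T * (T * (complex.Re p * complex.Re d + complex.Im p * complex.Im d)
   - nd * (complex.Re p * complex.Re z + complex.Im p * complex.Im z)) / (np * nd).
  apply: (mulfI (_ : 2 != 0)); first by rewrite pnatr_eq0.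
  apply: complexI; rewrite lorentz_smooth_discrete // !TE !normE !dotE.
  have ndC : nd%:C != 0 :> C by rewrite fmorph_eq0 gt_eqF.
  have npC : np%:C != 0 :> C by rewrite fmorph_eq0 gt_eqF.
  move: ndC npC; rewrite !realCE => ndC npC; field.
  exact/andP.
apply: (iff_trans (spacelike_plane _ _ _ _ Ueq _ _)).
- rewrite lorentz_congr ?smooth_dir_herm // PP mulr_gt0 // divr_gt0 // exprn_even_gt0 //.
- by move=> x; apply: independent_dirs => //; rewrite TE fmorph_eq0.
rewrite !lorentz_congr ?smooth_dir_herm ?discrete_dir_herm // PP QQ PQ.
set B := _ - nd * _; set e := complex.Re _.
(* This square is a common factor of both sides of the Gram inequality. *)
have k0 : 0 < (e * T / (np * nd)) ^+ 2.
  by rewrite exprn_even_gt0 //= !mulf_eq0 invr_eq0 mulf_eq0 !negb_or T0 !gt_eqF.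
rewrite -[X in _ <-> is_true X](ltr_pM2l k0).
have -> : (e * (T * B / (np * nd))) ^+ 2 = (e * T / (np * nd)) ^+ 2 * B ^+ 2.
  by ring.
have -> // : e * (T ^+ 2 / np) * (e * (T * T1 * (1 - a) / nd)) =
  (e * T / (np * nd)) ^+ 2 * (T * T1 * (1 - a) * np * nd).
by field; rewrite !gt_eqF.
Qed.

(** * Derivatives of complex and matrix valued functions *)

(** Differentiability is recorded along with the value, which [cderive] alone does not do; the rules
    of calculus then compose. *)
Definition is_cderive (f : R -> C) (t : R) (l : C) : Prop :=
  is_derive t 1 (@complex.Re R \o f) (complex.Re l) /\
  is_derive t 1 (@complex.Im R \o f) (complex.Im l).

Lemma is_cderive_eq (f h : R -> C) t l l' :
  is_cderive f t l -> f =1 h -> l = l' -> is_cderive h t l'.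
Proof. by move=> fl /funext <- <-. Qed.

Lemma csmooth_is_cderive (A : set R) (f : R -> C) t : csmooth_on A f -> A t ->
  is_cderive f t (cderive f t).
Proof.
move=> [fr fi] At; rewrite /is_cderive /cderive /= !derive1E.
by split; apply: derivableP; [move: (fr 0%N t At) | move: (fi 0%N t At)];
  rewrite derive1n0.
Qed.

Lemma is_cderive_cst l t : is_cderive (cst l) t 0.
Proof. by split; exact: is_derive_cst. Qed.

Lemma is_cderiveD (f h : R -> C) t l l' : is_cderive f t l -> is_cderive h t l' ->
  is_cderive (fun s => f s + h s) t (l + l').
Proof.
move=> [fr fi] [hr hi]; split; rewrite raddfD.
  rewrite [X in is_derive _ _ X](_ : _ = (@complex.Re R \o f) + (@complex.Re R \o h)).
    exact: is_deriveD.
  by apply/funext => s /=; rewrite raddfD.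
rewrite [X in is_derive _ _ X](_ : _ = (@complex.Im R \o f) + (@complex.Im R \o h)).
  exact: is_deriveD.
by apply/funext => s /=; rewrite raddfD.
Qed.

Lemma is_cderiveN (f : R -> C) t l : is_cderive f t l ->
  is_cderive (fun s => - f s) t (- l).
Proof.
move=> [fr fi]; split; rewrite raddfN.
  rewrite [X in is_derive _ _ X](_ : _ = - (@complex.Re R \o f)).
    exact: is_deriveN.
  by apply/funext => s /=; rewrite raddfN.
rewrite [X in is_derive _ _ X](_ : _ = - (@complex.Im R \o f)).
  exact: is_deriveN.
by apply/funext => s /=; rewrite raddfN.
Qed.

Lemma is_cderive_conj (f : R -> C) t l : is_cderive f t l ->
  is_cderive (fun s => Num.conj (f s)) t (Num.conj l).
Proof.
have ReJ (z : C) : complex.Re (Num.conj z) = complex.Re z by case: z.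
have ImJ (z : C) : complex.Im (Num.conj z) = - complex.Im z by case: z.
move=> [fr fi]; split; rewrite ?ReJ ?ImJ.
  rewrite [X in is_derive _ _ X](_ : _ = (@complex.Re R \o f)) //.
  by apply/funext => s /=; rewrite ReJ.
rewrite [X in is_derive _ _ X](_ : _ = - (@complex.Im R \o f)).
  exact: is_deriveN.
by apply/funext => s /=; rewrite ImJ.
Qed.

Lemma is_cderiveM (f h : R -> C) t l l' : is_cderive f t l -> is_cderive h t l' ->
  is_cderive (fun s => f s * h s) t (l * h t + f t * l').
Proof.
have ReM (z z' : C) : complex.Re (z * z') =
    complex.Re z * complex.Re z' - complex.Im z * complex.Im z' by case: z z' => ? ? [].
have ImM (z z' : C) : complex.Im (z * z') =
    complex.Re z * complex.Im z' + complex.Im z * complex.Re z' by case: z z' => ? ? [].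
move=> [fr fi] [hr hi]; split; rewrite raddfD.
  rewrite [X in is_derive _ _ X](_ : _ =
    (@complex.Re R \o f) * (@complex.Re R \o h) - (@complex.Im R \o f) * (@complex.Im R \o h)).
    apply: (is_derive_eq (is_deriveB (is_deriveM fr hr) (is_deriveM fi hi))) => /=.
    by rewrite !ReM /GRing.scale /=; ring.
  by apply/funext => s /=; rewrite ReM.
rewrite [X in is_derive _ _ X](_ : _ =
  (@complex.Re R \o f) * (@complex.Im R \o h) + (@complex.Im R \o f) * (@complex.Re R \o h)).
  apply: (is_derive_eq (is_deriveD (is_deriveM fr hi) (is_deriveM fi hr))) => /=.
  by rewrite !ImM /GRing.scale /=; ring.
by apply/funext => s /=; rewrite ImM.
Qed.

(** The inverse is the conjugate of f over |f|^2, and |f|^2 has derivative 0 as well. This serves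
    for f = det E, whose derivative vanishes because E^-1 E' is traceless. *)
Lemma is_cderiveV0 (f : R -> C) t : f t != 0 -> is_cderive f t 0 ->
  is_cderive (fun s => (f s)^-1) t 0.
Proof.
move=> f0 [fr fi]; pose n2 s := complex.Re (f s) ^+ 2 + complex.Im (f s) ^+ 2.
have n20 : n2 t != 0.
  rewrite /n2 paddr_eq0 ?sqr_ge0 // !sqrf_eq0.
  by move: f0; case: (f t) => ? ?; rewrite eq_complex.
have dn2 : is_derive t 1 n2 0.
  rewrite (_ : n2 = (@complex.Re R \o f) * (@complex.Re R \o f)
    + (@complex.Im R \o f) * (@complex.Im R \o f)); last first.
    by apply/funext => s; rewrite /n2 !expr2.
  apply: (is_derive_eq (is_deriveD (is_deriveM fr fr) (is_deriveM fi fi))) => /=.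
  by rewrite !scaler0 !addr0.
have dn2V : is_derive t 1 (fun s => (n2 s)^-1) 0.
  by apply: (is_derive_eq (is_deriveV n20 dn2)); rewrite scaler0.
split.
  rewrite [X in is_derive _ _ X](_ : _ = (@complex.Re R \o f) * (fun s => (n2 s)^-1)).
    by apply: (is_derive_eq (is_deriveM fr dn2V)); rewrite !scaler0 addr0.
  by apply/funext => s /=; rewrite /n2 /GRing.mul /=; case: (f s).
rewrite [X in is_derive _ _ X](_ : _ = - ((@complex.Im R \o f) * (fun s => (n2 s)^-1))).
  by apply: (is_derive_eq (is_deriveN (is_deriveM fi dn2V))); rewrite !scaler0 addr0 oppr0.
by apply/funext => s; rewrite /= !fctE /n2 /=; case: (f s).
Qed.

Definition is_mxderive (F : R -> 'M[C]_2) (t : R) (L : 'M[C]_2) : Prop :=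
  forall i j, is_cderive (fun s => F s i j) t (L i j).

Lemma mxsmooth_is_mxderive (A : set R) (F : R -> 'M[C]_2) t :
  mxsmooth_on A F -> A t -> is_mxderive F t (mxderive F t).
Proof. by move=> FA At i j; rewrite mxE; apply: csmooth_is_cderive (FA i j) At. Qed.

Lemma is_mxderiveM (F H : R -> 'M[C]_2) t L L' :
  is_mxderive F t L -> is_mxderive H t L' ->
  is_mxderive (fun s => F s *m H s) t (L *m H t + F t *m L').
Proof.
have mulE A B i j : (A *m B) i j = A i 0 * B 0 j + A i 1 * B 1 j :> C.
  rewrite mxE big_ord_recl big_ord1; congr (_ + A i _ * B _ j); exact/val_inj.
move=> FL HL i j.
apply: (is_cderive_eq _ _ _ _ _ (is_cderiveD _ _ _ _ _
  (is_cderiveM _ _ _ _ _ (FL i 0) (HL 0 j)) (is_cderiveM _ _ _ _ _ (FL i 1) (HL 1 j)))).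
  by move=> s; rewrite mulE.
by rewrite mxE !mulE; ring.
Qed.

Lemma is_mxderive_conjtr (F : R -> 'M[C]_2) t L :
  is_mxderive F t L -> is_mxderive (fun s => conjtr (F s)) t (conjtr L).
Proof.
move=> FL i j; apply: (is_cderive_eq _ _ _ _ _ (is_cderive_conj _ _ _ (FL j i))).
  by move=> s; rewrite !mxE.
by rewrite !mxE.
Qed.

Lemma is_mxderiveZ (c : R -> C) (F : R -> 'M[C]_2) t l L :
  is_cderive c t l -> is_mxderive F t L ->
  is_mxderive (fun s => c s *: F s) t (l *: F t + c t *: L).
Proof.
move=> cl FL i j; apply: (is_cderive_eq _ _ _ _ _ (is_cderiveM _ _ _ _ _ cl (FL i j))).
  by move=> s; rewrite !mxE.
by rewrite !mxE.
Qed.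

(** Jacobi's formula. *)
Lemma is_cderive_det (F : R -> 'M[C]_2) t (V : 'M[C]_2) :
  is_mxderive F t (F t *m V) -> is_cderive (fun s => \det (F s)) t (\tr V * \det (F t)).
Proof.
move=> FV; apply: (is_cderive_eq _ _ _ _ _ (is_cderiveD _ _ _ _ _
  (is_cderiveM _ _ _ _ _ (FV 0 0) (FV 1 1))
  (is_cderiveN _ _ _ (is_cderiveM _ _ _ _ _ (FV 0 1) (FV 1 0))))).
  by move=> s; rewrite det_mx22E.
rewrite det_mx22E /mxtrace !mxE !big_ord_recl !big_ord0.
by rewrite (_ : lift 0 0 = 1); [ring | apply/val_inj].
Qed.

Lemma is_derive_vec_of_herm (F : R -> 'M[C]_2) t L : is_mxderive F t L ->
  is_derive t 1 (fun s => vec_of_herm (F s)) (vec_of_herm L).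
Proof.
move=> FL.
have coord j : is_derive t 1 (fun s => vec_of_herm (F s) 0 j) (vec_of_herm L 0 j).
  have [r00 _] := FL 0 0; have [r11 _] := FL 1 1; have [r10 i10] := FL 1 0.
  have dD : is_derive t 1 (fun s => (complex.Re (F s 0 0) + complex.Re (F s 1 1)) / 2)
      ((complex.Re (L 0 0) + complex.Re (L 1 1)) / 2).
    have H := is_deriveM (is_deriveD r00 r11) (is_derive_cst (2^-1 : R) t 1).
    apply: (is_derive_eq H).
    by rewrite scaler0 add0r /GRing.scale /= mulrC.
  have dB : is_derive t 1 (fun s => (complex.Re (F s 0 0) - complex.Re (F s 1 1)) / 2)
      ((complex.Re (L 0 0) - complex.Re (L 1 1)) / 2).
    have H := is_deriveM (is_deriveB r00 r11) (is_derive_cst (2^-1 : R) t 1).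
    apply: (is_derive_eq H).
    by rewrite scaler0 add0r /GRing.scale /= mulrC.
  rewrite (_ : (fun s => _) =
    fun s => nth 0 [:: complex.Re (F s 1 0); complex.Im (F s 1 0);
      (complex.Re (F s 0 0) - complex.Re (F s 1 1)) / 2;
      (complex.Re (F s 0 0) + complex.Re (F s 1 1)) / 2] j); last first.
    by apply/funext => s; rewrite mxE.
  by rewrite mxE; case: j => [[|[|[|[|//]]]]] lt_j.
have dF : derivable (fun s => vec_of_herm (F s)) t 1.
  by apply/derivable_mxP => i j; rewrite ord1; case: (coord j).
apply: DeriveDef => //; rewrite derive_mx //.
by apply/rowP => j; rewrite mxE derive_val.
Qed.

Lemma is_mxderive_gauss (f : R -> C) t p : is_cderive f t p ->
  is_mxderive (fun s => gauss_mx (f s)) t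
    (mx22 (p * Num.conj (f t) + f t * Num.conj p) (- p) (- Num.conj p) 0).
Proof.
move=> fp i j; have cfp := is_cderive_conj _ _ _ fp.
case: (ord2P i) => ->; case: (ord2P j) => ->.
- apply: (is_cderive_eq _ _ _ _ _ (is_cderiveD _ _ _ _ _
    (is_cderiveM _ _ _ _ _ fp cfp) (is_cderive_cst (- 1) t))).
    by move=> s; rewrite mxE.
  by rewrite mxE addr0.
- by apply: (is_cderive_eq _ _ _ _ _ (is_cderiveN _ _ _ fp)) => [s|]; rewrite mxE.
- by apply: (is_cderive_eq _ _ _ _ _ (is_cderiveN _ _ _ cfp)) => [s|]; rewrite mxE.
by apply: (is_cderive_eq _ _ _ _ _ (is_cderive_cst 1 t)) => [s|]; rewrite mxE.
Qed.

Lemma cmc1_is_derive (g : int -> R -> C) (E : int -> R -> 'M[C]_2) k t p (mu : R) :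
  (\near t, calT (g k t) != 0) -> is_cderive (g k) t p -> p != 0 ->
  E k t \in unitmx -> is_mxderive (E k) t (E k t *m mx22 0 p (mu%:C / p) 0) ->
  is_derive t 1 (cmc1 g E k) (vec_of_herm ((\det (E k t))^-1 *:
    ((- mu)%:C *: congr (E k t) (smooth_dir (g k t) p)))).
Proof.
move=> T0 gp p0 Eu EV.
have cp0 : Num.conj p != 0 by rewrite fmorph_eq0.
have det0 : \det (E k t) != 0 by rewrite -unitfE -unitmxE.
have dV : is_cderive (fun s => (\det (E k s))^-1) t 0.
  apply: (is_cderiveV0 (fun s => \det (E k s))) => //.
  apply: (is_cderive_eq _ _ _ _ _ (is_cderive_det _ _ _ EV)) => //.
  by rewrite /mxtrace !big_ord_recl big_ord0 !mxE /= !addr0 mul0r.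
have dC := is_mxderiveM _ _ _ _ _ (is_mxderiveM _ _ _ _ _ EV (is_mxderive_gauss _ _ _ gp))
  (is_mxderive_conjtr _ _ _ EV).
have := is_derive_vec_of_herm _ _ _ (is_mxderiveZ _ _ _ _ _ dV dC).
rewrite scale0r add0r conjtrM.
rewrite [in X in is_derive _ _ _ X](_ : _ + _ = (- mu)%:C *: congr (E k t) (smooth_dir (g k t) p)).
  (* The root-free formula for n requires T to be nonzero, hence it is used on a neighbourhood of
     t. *)
  by apply: near_eq_is_derive; near=> s; rewrite cmc1E //; near: s.
rewrite -congrZ (_ : _ *: smooth_dir _ _ = mx22 0 p (mu%:C / p) 0 *m gauss_mx (g k t)
    + mx22 (p * Num.conj (g k t) + g k t * Num.conj p) (- p) (- Num.conj p) 0
    + gauss_mx (g k t) *m conjtr (mx22 0 p (mu%:C / p) 0)).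
  by rewrite /congr !(mulmxDr, mulmxDl) !mulmxA.
rewrite /gauss_mx /smooth_dir conjtr_mx22 !mx22M !mx22Z !mx22D !conjE !realCE.
by congr mx22; field; rewrite ?p0 ?cp0.
Unshelve. all: by end_near.
Qed.

(** * Singular edges *)

(** A countable set has Lebesgue measure 0, whereas the interval has positive length. *)
Lemma exists_notin_countable (S : set R) a b : countable S -> a < b ->
  exists2 x, a < x < b & ~ S x.
Proof.
move=> Sc ab; apply: contrapT => noS.
have abS : `]a, b[ `<=` S.
  move=> x; rewrite /= in_itv /= => xab; apply: contrapT => Sx; apply: noS.
  by exists x.
have := countable_lebesgue_measure0 (sub_countable (subset_card_le abS) Sc).
rewrite lebesgue_measure_itv /= lte_fin ab -EFinB => /eqP.
by rewrite eqe subr_eq0 gt_eqF.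
Qed.

Lemma exists_admissible (D : int -> set R) (sigma : int -> R) a b : a < b ->
  exists2 lam, a < lam < b & admissible D sigma lam.
Proof.
move=> ab.
(* [None] excludes lam = 0 and [Some k] the root of 1 - lam * sigma k. If sigma k = 0 there is no
   root, and the inverse, which is then 0 by convention, excludes 0 once more. *)
pose bad (o : option int) := if o is Some k then (sigma k)^-1 else 0.
have badC : countable (range bad).
  exact: sub_countable (card_image_le _ _) (countableP _).
have [lam lamab nbad] := exists_notin_countable _ _ _ badC ab.
exists lam => //; split=> [|k t _].
  by apply/eqP => lam0; apply: nbad; exists None.
rewrite subr_eq0; apply/eqP => lamk; apply: nbad; exists (Some k) => //=.
have s0 : sigma k != 0.
  by apply/eqP => s0; move/eqP: lamk; rewrite s0 mulr0 oner_eq0.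
by apply: (mulIf s0); rewrite mulVf.
Qed.

Lemma tangent_circle_criterion z p d (p1 : C) q :
  let T := 1 - complex.Re z ^+ 2 - complex.Im z ^+ 2 in
  let T1 := 1 - complex.Re (z + d) ^+ 2 - complex.Im (z + d) ^+ 2 in
  let np := complex.Re p ^+ 2 + complex.Im p ^+ 2 in
  let nd := complex.Re d ^+ 2 + complex.Im d ^+ 2 in
  p != 0 -> d != 0 -> p * p1 = q%:C * d ^+ 2 ->
  (exists c : gcircle R,
     [/\ gcircle_wf c, tangent_to c z p, tangent_to c (z + d) p1 &
         meets_transversally c (unit_circle R)]) <->
  T * T1 * np * nd <
  (T * (complex.Re p * complex.Re d + complex.Im p * complex.Im d)
   - nd * (complex.Re p * complex.Re z + complex.Im p * complex.Im z)) ^+ 2.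
Proof.
case: z p d p1 => [a b] [u v] [x y] [w s] /= p0 d0 pp1.
apply: (iff_trans (tangent_circle_meets_unit _ _ _ _ _ _ _ _ _ p0 d0 pp1)).
set m := x ^+ 2 + y ^+ 2; set n := u ^+ 2 + v ^+ 2.
set T := 1 - a ^+ 2 - b ^+ 2; set T1 := 1 - _ - _.
(* A and B are the imaginary and real parts of p (T conj d - |d|^2 conj z). *)
set A := _ - _; set B := _ - _.
(* The squared modulus of that number; it exchanges an upper bound on A^2 for a lower bound on
   B^2. *)
have AB : A ^+ 2 + B ^+ 2 = T * T1 * n * m + m ^+ 2 * n.
  by rewrite /A /B /T /T1 /n /m; ring.
by split; move: AB; lra.
Qed.

Lemma step_eq (E E1 : 'M[C]_2) d a : E \in unitmx ->
  invmx E *m (E1 - E) = mx22 0 d (a%:C / d) 0 -> E1 = E *m step_mx d a.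
Proof.
move=> Eu /(congr1 (mulmx E)); rewrite mulKVmx // => E1E.
rewrite -(subrK E E1) E1E -[X in _ + X]mulmx1 -mulmxDr mx22_id mx22D /step_mx.
by rewrite !(add0r, addr0).
Qed.

Lemma is_derive1_val (V : normedModType R) (f : R -> V) (t : R) (l : V) :
  is_derive t 1 f l -> derive1 f t = l.
Proof. by move=> fl; rewrite derive1E derive_val. Qed.

Lemma derive1_delta (V : normedModType R) (y : int -> R -> V) k (t : R) (l l' : V) :
  is_derive t 1 (y k) l -> is_derive t 1 (y (k + 1)) l' ->
  derive1 (delta y k) t = l' - l.
Proof. by move=> yl yl'; exact: (is_derive1_val _ _ _ _ (is_deriveB yl' yl)). Qed.

(** The shape taken by the span of the derivative of n, its difference and its mixed derivative: the
    first two are nonzero multiples of u and w, and the third is a combination of both. *)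
Lemma eqmx_plane (u w : 'rV[R]_4) a b x y : a != 0 -> b != 0 ->
  (a *: u + b *: w + (x *: u + y *: w)%R == u + w)%MS.
Proof.
move=> a0 b0; apply/andP; split.
  rewrite !addsmx_sub !scalemx_sub ?addsmxSl ?addsmxSr //=.
  by rewrite addmx_sub // scalemx_sub ?addsmxSl ?addsmxSr.
have sub (c : R) (v : 'rV[R]_4) : c != 0 -> (v <= c *: v)%MS.
  by move=> c0; rewrite (eqmx_scale _ c0).
apply: submx_trans (addsmxSl _ _).
by rewrite addsmxS ?sub.
Qed.

(* Unfolded, these are matrix literals, on which unification up to scaling
   diverges. *)
Local Opaque cmc1 vec_of_herm congr gauss_mx smooth_dir discrete_dir step_mx.

Lemma vec_of_herm_congr_comb E X Y x y :
  vec_of_herm (congr E (x%:C *: X + y%:C *: Y)) =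
  x *: vec_of_herm (congr E X) + y *: vec_of_herm (congr E Y).
Proof. by rewrite congrD !congrZ vec_of_hermD !vec_of_hermZ. Qed.

Lemma vec_of_hermZV x A : vec_of_herm ((x%:C)^-1 *: A) = x^-1 *: vec_of_herm A.
Proof. by rewrite -fmorphV vec_of_hermZ. Qed.

(** The two [gauss_mx] terms cancel because the determinant of the frame is multiplied by 1 - a
    along the edge. *)
Lemma vec_delta_gauss E z d a x : d != 0 -> x != 0 -> 1 - a != 0 ->
  vec_of_herm (((x * (1 - a))%:C)^-1 *: congr (E *m step_mx d a) (gauss_mx (z + d)))
  - vec_of_herm ((x%:C)^-1 *: congr E (gauss_mx z)) =
  (- a / (x * (1 - a))) *: vec_of_herm (congr E (discrete_dir z d a)).
Proof.
move=> d0 x0 a1; rewrite congr_mul congr_step_gauss //.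
have -> : - (a%:C *: discrete_dir z d a) = (- a)%:C *: discrete_dir z d a.
  by rewrite -scaleNr -rmorphN.
rewrite !vec_of_hermZV vec_of_herm_congr_comb.
move: (vec_of_herm _) (vec_of_herm _) => hM hQ.
rewrite scalerDr !scalerA addrAC -scalerBl.
have -> : (x * (1 - a))^-1 * (1 - a) - x^-1 = 0 by field; rewrite x0 a1.
by rewrite scale0r add0r mulrC.
Qed.

Lemma delta_cmc1 (g : int -> R -> C) (E : int -> R -> 'M[C]_2) k t d a x :
  calT (g k t) != 0 -> calT (g (k + 1) t) != 0 ->
  d != 0 -> x != 0 -> 1 - a != 0 ->
  g (k + 1) t = g k t + d -> E (k + 1) t = E k t *m step_mx d a ->
  \det (E k t) = x%:C -> \det (E (k + 1) t) = (x * (1 - a))%:C ->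
  delta (cmc1 g E) k t =
  (- a / (x * (1 - a))) *: vec_of_herm (congr (E k t) (discrete_dir (g k t) d a)).
Proof.
move=> T0 T1 d0 x0 a1 gE EE detE detE1.
rewrite -[RHS](vec_delta_gauss (E k t) (g k t) _ _ _ d0 x0 a1) -gE -EE -detE1 -detE.
rewrite -(cmc1E _ _ _ _ T1).
rewrite -(cmc1E _ _ _ _ T0).
reflexivity.
Qed.

Lemma singular_edge_criterion (D : int -> set R) (g : int -> R -> C)
    (sigma : int -> R) (tau : R -> R) (lam : R) (E : int -> R -> 'M[C]_2) k t :
  let z := g k t in let d := delta g k t in let p := cderive (g k) t in
  let T := 1 - complex.Re z ^+ 2 - complex.Im z ^+ 2 in
  let T1 := 1 - complex.Re (z + d) ^+ 2 - complex.Im (z + d) ^+ 2 in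
  let np := complex.Re p ^+ 2 + complex.Im p ^+ 2 in
  let nd := complex.Re d ^+ 2 + complex.Im d ^+ 2 in
  sd_domain D -> sd_holomorphic D g sigma tau ->
  (forall k t, D k t -> `|g k t| != 1) ->
  admissible D sigma lam -> cmc1_frame D g sigma tau lam E -> on_edge D k t ->
  singular_edge (cmc1 g E) k t <->
  ~ ((T * (complex.Re p * complex.Re d + complex.Im p * complex.Im d)
     - nd * (complex.Re p * complex.Re z + complex.Im p * complex.Im z)) ^+ 2
    < T * T1 * (1 - lam * sigma k) * np * nd).
Proof.
move=> z d p T T1 np nd hD hg hg1 [lam0 adm] hE edge.
have [Dk Dk1] := edge; have a1 := adm _ _ edge; set a := lam * sigma k in a1 *.
have calT0 l s : D l s -> calT (g l s) != 0.
  move=> Dls; rewrite subr_eq0 eq_sym sqrp_eq1 ?normr_ge0 //.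
  exact: hg1.
have calT_near l s : D l s -> \near s, calT (g l s) != 0.
  move=> Dls; have := open_nbhs_nbhs (conj (hD l) Dls).
  by apply: filterS => s' /calT0.
have p0 := sd_hol_partial hg Dk; have p10 := sd_hol_partial hg Dk1.
have d0 := sd_hol_delta hg edge; rewrite -/p -/d in p0 d0.
have T0 : 1 - z * Num.conj z != 0 by rewrite -calTE calT0.
have T0' : T != 0 by exact: Re2_Im2_neq1 (hg1 _ _ Dk).
have q0 : tau t / sigma k != 0 by rewrite lt_eqF // (sd_hol_cross_ratio_lt0 hg edge).
have tau0 : tau t != 0 by apply: contra q0 => /eqP ->; rewrite mul0r.
(* As the inverse of 0 is 0, a nonzero quotient also forces its denominator to be nonzero. *)
have sig0 : sigma k != 0 by apply: contra q0 => /eqP ->; rewrite invr0 mulr0.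
(* The cross ratio, solved for the derivative at the far vertex, gives the form in which planarity
   of the edge is available. *)
have p1E : cderive (g (k + 1)) t = (tau t / sigma k)%:C * d ^+ 2 / p.
  by rewrite -(sd_hol_cross_ratio hg edge) -/p -/d; field; rewrite p0 d0.
have zE : g (k + 1) t = z + d by rewrite /d /delta addrCA subrr addr0.
have Eu := frame_unit hE Dk; have E1u := frame_unit hE Dk1.
have E1E := step_eq _ _ _ _ Eu (frame_delta hE edge).
set E0 := E k t in Eu E1E; rewrite -/d -/a in E1E.
have det0 : \det E0 != 0 by rewrite -unitfE -unitmxE.
have [e eE] : exists e : R, \det E0 = e%:C.
  by apply/complex_realP; exact: frame_det_real hE _ _ Dk.
have e0 : e != 0 by move: det0; rewrite eE fmorph_eq0.
have det1 : \det (E (k + 1) t) = (e * (1 - a))%:C.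
  rewrite E1E det_mulmx eE det_mx22 !realCE; field.
  by rewrite d0.
pose mu := lam * tau t.
have mu0 : mu != 0 by rewrite mulf_neq0.
have dE l : D l t -> is_mxderive (E l) t (E l t *m mx22 0 (cderive (g l) t) (mu%:C / cderive (g l) t) 0).
  move=> Dl; rewrite -(frame_partial hE Dl) mulKVmx ?(frame_unit hE Dl) //.
  exact: mxsmooth_is_mxderive (frame_smooth hE l) Dl.
have dg l : D l t -> is_cderive (g l) t (cderive (g l) t).
  by move=> Dl; exact: csmooth_is_cderive (sd_hol_smooth hg l) Dl.
pose hP := vec_of_herm (congr E0 (smooth_dir z p)).
pose hQ := vec_of_herm (congr E0 (discrete_dir z d a)).
have dn := cmc1_is_derive _ _ _ _ _ _ (calT_near _ _ Dk) (dg _ Dk) p0 Eu (dE _ Dk).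
have dn1 := cmc1_is_derive _ _ _ _ _ _ (calT_near _ _ Dk1) (dg _ Dk1) p10 E1u (dE _ Dk1).
have [x [y xyE]] := congr_step_smooth z p d a _ p0 d0 q0 T0.
have combE (c r : R) (u w : 'rV[R]_4) :
    c *: (x *: u + y *: w) - r *: u = (c * x - r) *: u + (c * y) *: w.
  by rewrite scalerDr !scalerA addrAC -scalerBl.
have nE := delta_cmc1 _ _ _ _ _ _ _ (calT0 _ _ Dk) (calT0 _ _ Dk1) d0 e0 a1 zE E1E eE det1.
have dnE := is_derive1_val _ _ _ _ dn.
have ddnE := derive1_delta _ _ _ _ _ _ dn dn1.
rewrite -/z -/p -/E0 eE vec_of_hermZV vec_of_hermZ scalerA -/hP in dnE ddnE.
rewrite det1 vec_of_hermZV vec_of_hermZ scalerA in ddnE.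
rewrite zE p1E E1E congr_mul xyE vec_of_herm_congr_comb -/hP -/hQ in ddnE.
move: (ddnE); rewrite combE => {}ddnE.
have c0 : e^-1 * - mu != 0 by rewrite mulf_neq0 ?invr_eq0 ?oppr_eq0.
have c1 : - a / (e * (1 - a)) != 0.
  by rewrite !mulf_neq0 ?oppr_eq0 ?invr_eq0 ?mulf_neq0.
rewrite /singular_edge.
suff -> : spacelike (derive1 (cmc1 g E k) t + delta (cmc1 g E) k t +
    derive1 (delta (cmc1 g E) k) t)%MS <->
  ((T * (complex.Re p * complex.Re d + complex.Im p * complex.Im d)
     - nd * (complex.Re p * complex.Re z + complex.Im p * complex.Im z)) ^+ 2
    < T * T1 * (1 - a) * np * nd) by [].
apply: (spacelike_edge_plane _ _ E0) => //.
rewrite dnE nE ddnE; exact: eqmx_plane.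
Qed.

End SemiDiscreteCMC1.

(** * The limit of small lambda *)

Theorem theorem5p4 (R : realType) (D : int -> set R) (g : int -> R -> R[i])
    (sigma : int -> R) (tau : R -> R) (E : R -> int -> R -> 'M[R[i]]_2)
    (hD : sd_domain D)
    (hg : sd_holomorphic D g sigma tau)
    (hg1 : forall k t, D k t -> `|g k t| != 1)
    (hE : \forall lam \near (0 : R)^', admissible D sigma lam ->
            cmc1_frame D g sigma tau lam (E lam))
    (k : int) (t : R) (hk : D k t) (hk1 : D (k + 1) t) :
  (\forall lam \near (0 : R)^', admissible D sigma lam ->
     singular_edge (cmc1 g (E lam)) k t)
  <->
  (exists c : gcircle R,
     [/\ gcircle_wf c,
         tangent_to c (g k t) (cderive (g k) t),
         tangent_to c (g (k + 1) t) (cderive (g (k + 1)) t) &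
         meets_transversally c (unit_circle R)]).
Proof.
have edge : on_edge D k t by [].
have p0 := sd_hol_partial hg hk.
have d0 := sd_hol_delta hg edge.
have q0 : tau t / sigma k != 0 by rewrite lt_eqF // (sd_hol_cross_ratio_lt0 hg edge).
have sig0 : sigma k != 0 by apply: contra q0 => /eqP ->; rewrite invr0 mulr0.
have pp1 : cderive (g k) t * cderive (g (k + 1)) t = (tau t / sigma k)%:C * delta g k t ^+ 2.
  by rewrite -(sd_hol_cross_ratio hg edge) divfK // expf_neq0.
rewrite (_ : g (k + 1) t = g k t + delta g k t); last by rewrite /delta addrCA subrr addr0.
have crit lam := @singular_edge_criterion R D g sigma tau lam (E lam) k t hD hg hg1.
apply: iff_trans (iff_sym (@tangent_circle_criterion R _ _ _ _ _ p0 d0 pp1)).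
move: crit; cbv zeta.
set T := 1 - complex.Re (g k t) ^+ 2 - _; set T1 := 1 - _ - _.
set B := (_ - _) ^+ 2; set np := complex.Re (cderive _ _) ^+ 2 + _; set nd := _ + _ => crit.
set K := T * T1 * np * nd.
have KE lam : T * T1 * (1 - lam * sigma k) * np * nd = K - lam * (K * sigma k).
  by rewrite /K; ring.
(* In the borderline case B = K the sign of lam * sigma decides, so the edge is
   nonsingular for arbitrarily small lam of one sign. *)
split=> [sing | KB].
  rewrite ltNge; apply/negP => BK.
  (* K is bounded below by the square B and none of its factors vanishes. *)
  have K0 : 0 < K.
    rewrite lt0r (le_trans (sqr_ge0 _) BK) andbT /K !mulf_neq0 //.
    - exact: Re2_Im2_neq1 (hg1 _ _ hk).
    - by rewrite /T1 /delta addrCA subrr addr0 Re2_Im2_neq1 // hg1.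
    - by rewrite gt_eqF // Re2_Im2_gt0.
    - by rewrite gt_eqF // Re2_Im2_gt0.
  have [e /= e0 He] := (nbhs_ballP _ _).1 (filterI hE sing).
  (* If lam * (K * sigma k) were negative, the right side K - lam * (K * sigma k) of the criterion
     would exceed K and hence B, making the edge nonsingular. *)
  have sing_lt0 lam : `|lam| < e -> admissible D sigma lam -> 0 <= lam * (K * sigma k).
    move=> lame adm; rewrite leNgt; apply/negP => lamK.
    have [||hEl singl] := He lam; first by rewrite /ball /= sub0r normrN.
      by case: adm.
    have /(crit _ adm (hEl adm) edge) := singl adm; apply.
    by rewrite KE; lra.
  have [sigk_lt0|sigk_gt0|sigk0] := ltgtP (sigma k) 0.
  - have [lam /andP[lam0 lame] adm] := @exists_admissible R D sigma 0 e e0.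
    have := sing_lt0 lam; rewrite gtr0_norm // => /(_ lame adm).
    by rewrite leNgt !pmulr_rlt0 // sigk_lt0.
  - have [|lam /andP[lame lam0] adm] := @exists_admissible R D sigma (- e) 0.
      by rewrite oppr_lt0.
    have := sing_lt0 lam; rewrite ltr0_norm // ltrNl => /(_ lame adm).
    by rewrite leNgt nmulr_rlt0 // mulr_gt0.
  by rewrite sigk0 eqxx in sig0.
(* The gap B - K absorbs the perturbation lam * (K * sigma k) once |lam| is below this quotient; the
   added 1 keeps the denominator positive. *)
have c0 : 0 < `|K * sigma k| + 1 by rewrite ltr_wpDl.
have e0 : 0 < (B - K) / (`|K * sigma k| + 1) by rewrite divr_gt0 ?subr_gt0.
near=> lam => adm; apply/(crit _ adm _ edge); first by move: adm; near: lam.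
rewrite KE; apply/negP; rewrite -leNgt.
have : `|lam| < (B - K) / (`|K * sigma k| + 1) by near: lam; exact: dnbhs0_lt.
rewrite ltr_pdivlMr // mulrDr mulr1 -normrM.
have := ler_norm (- (lam * (K * sigma k))); rewrite normrN; have := normr_ge0 lam.
by lra.
Unshelve. all: by end_near.
Qed.
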